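(* If $K/\mathbb{Q}$ is a totally real Galois extension of degree $8$, then $K$ contains algebraic units which are wandering under iteration of the Mahler measure $M$.
   Context: Fix an algebraic closure $\overline{\mathbb{Q}}\subseteq\mathbb{C}$ of $\mathbb{Q}$; number fields are subfields of $\overline{\mathbb{Q}}$. For $\alpha\in\overline{\mathbb{Q}}$ with (primitive) minimal polynomial $f(x)=a_nx^n+\cdots+a_0=a_n(x-\alpha_1)\cdots(x-\alpha_n)\in\mathbb{Z}[x]$ (so $f$ is irreducible in $\mathbb{Z}[x]$), the Mahler measure of $\alpha$ is $M(\alpha)=|a_n|\prod_{i=1}^n\max\{1,|\alpha_i|\}$. This is again an algebraic number, so $M$ is a map $\overline{\mathbb{Q}}\to\overline{\mathbb{Q}}$. Put $M^0(\alpha)=\alpha$ and $M^n(\alpha)=M(M^{n-1}(\alpha))$ for $n\ge1$. The point $\alpha$ is wandering (under iteration of $M$) if its forward orbit $\{M^n(\alpha):n\ge0\}$ is infinite. An algebraic unit in $K$ is a unit of the ring of integers of $K$. *)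

(* Defs.v *)
From HB Require Import structures.
From mathcomp Require Import all_boot all_order all_algebra all_field.
From mathcomp Require Import boolp classical_sets functions cardinality.

Set Implicit Arguments.
Unset Strict Implicit.
Unset Printing Implicit Defensive.

Import Order.TTheory GRing.Theory Num.Theory.
Local Open Scope ring_scope.

(* algC is the field of algebraic numbers with its complex absolute value;
   a number field K is given together with an embedding of K into algC. *)

(* The primitive minimal polynomial, with positive leading coefficient: clear
   the denominators of the monic minimal polynomial over rat, then divide by
   the content. *)
Definition minZpoly (x : algC) : {poly int} :=
  zprimitive (tag (rat_poly_scale (sval (minCpolyP x)))).

(* The roots in algC, listed with multiplicity. *)
Definition algC_roots (p : {poly algC}) : seq algC :=
  sval (closed_field_poly_normal p).

Definition mahler (x : algC) : algC :=
  let f := map_poly intr (minZpoly x) : {poly algC} in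
  `|lead_coef f| * \prod_(z <- algC_roots f) Num.max 1 `|z|.

Definition mahler_orbit (x : algC) : set algC :=
  [set y | exists n : nat, y = iter n mahler x]%classic.

Definition wandering (x : algC) : Prop := infinite_set (mahler_orbit x).

Definition totally_real (K : fieldExtType rat) : Prop :=
  forall (sigma : {rmorphism K -> algC}) (x : K), sigma x \is Num.real.

(* Integrality of elements of K is tested on their images in algC. *)
Definition algebraic_unit (K : fieldExtType rat) (iota : {rmorphism K -> algC})
    (u : K) : Prop :=
  iota u \in Aint /\ exists2 v : K, iota v \in Aint & u * v = 1.

Lemma minZpolyP (x : algC) :
  [/\ zcontents (minZpoly x) = 1, 0 < lead_coef (minZpoly x),
      irreducible_poly (minZpoly x)
    & map_poly intr (minZpoly x) = (lead_coef (minZpoly x))%:~R *: minCpoly x].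
Proof.
rewrite /minZpoly; case: (minCpolyP x) => p [Dp mon_p] dv_p /=.
case: (rat_poly_scale p) => q [a nz_a Dq] /=.
have nz_q : q != 0.
  apply: contraTneq (monic_neq0 mon_p) => q0.
  by rewrite Dq q0 rmorph0 scaler0 eqxx.
set f := zprimitive q; pose c : rat := (zcontents q)%:~R / a%:~R.
have nz_c : c != 0 by rewrite mulf_neq0 ?invr_eq0 ?intr_eq0 ?zcontents_eq0.
have Dpf : p = c *: map_poly intr f.
  rewrite Dq {1}[q]zpolyEprim -/f map_polyZ /= scalerA mulrC.
  by [].
have Dcf : map_poly intr f = c^-1 *: p by rewrite Dpf scalerA mulVf ?scale1r.
have Dc : c^-1 = (lead_coef f)%:~R.
  have := congr1 lead_coef Dcf; rewrite lead_coefZ (monicP mon_p) mulr1 => <-.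
  by rewrite lead_coef_map_inj //; apply: intr_inj.
have irr_p : irreducible_poly p.
  have root_p : root (map_poly ratr p) x by rewrite dv_p dvdpp.
  split=> [|r nz_r dv_r].
    by have := size_minCpoly x; rewrite Dp size_map_poly.
  have [s Dps] := dvdpP _ _ dv_r.
  have nz_p := monic_neq0 mon_p.
  have nz_s : s != 0 by apply: contraNneq nz_p => s0; rewrite Dps s0 mul0r.
  have nz_r0 : r != 0 by apply: contraNneq nz_p => r0; rewrite Dps r0 mulr0.
  move: root_p; rewrite {1}Dps rmorphM rootM !dv_p => /orP[] dv_pr.
    have := dvdp_leq nz_s dv_pr; rewrite {1}Dps size_mul //.
    have := nz_r; have := nz_r0; rewrite -size_poly_gt0.
    case: (size r) => [|[|k]] // _ _.
    by rewrite !addnS /= -[X in (_ <= X)%N]addn0 ltn_add2l.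
  by rewrite /eqp dv_r dv_pr.
split.
- by rewrite zcontents_primitive nz_q.
- by rewrite -sgz_gt0 sgz_lead_primitive nz_q.
- apply/irreducible_rat_int; rewrite Dcf; split.
    by rewrite size_scale ?invr_eq0 //; case: irr_p.
  have [_ irr] := irr_p; move=> r nr; rewrite dvdpZr ?invr_eq0 // => /(irr _ nr) e.
  by apply: eqp_trans e _; rewrite eqp_sym eqp_scale ?invr_eq0.
have := congr1 (map_poly (ratr : rat -> algC)) Dcf.
rewrite -map_poly_comp map_polyZ /= Dc ratr_int Dp => <-.
by apply: eq_map_poly => i /=; rewrite ratr_int.
Qed.

(* Main.v *)
Require Import Defs.
From HB Require Import structures.
From mathcomp Require Import all_boot all_order all_algebra all_field.
From mathcomp Require Import all_fingroup all_solvable mxabelem ring zify.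
From mathcomp Require cardinality.

Set Implicit Arguments.
Unset Strict Implicit.
Unset Printing Implicit Defensive.

Import Order.TTheory GRing.Theory Num.Theory.
Local Open Scope ring_scope.

(** Write G for the Galois group. For an algebraic integer x of K the Mahler
    measure is the product of max 1 |y| over the distinct conjugates y of x
    ([mahler_conjugates]), so M sends totally positive units of K to units of
    K. If y > 1 is such a unit, then M(y) >= y, and the inequality is strict
    as soon as y has a second conjugate beyond 1. Hence a unit wanders when
    all its iterates keep two conjugates beyond 1 ([wandering_invariant]), and
    it suffices to find a property of units that M preserves and that forces
    such a second conjugate.

    Suppose first that some h in G has order 4. As the group has order 8, the
    subgroup generated by h has index 2 and z = h^2 is central
    ([square_central]). Consider the totally positive units y > 1 with
    z y = 1/y. Centrality of z makes the property pass from y to M(y), since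
    M(y) is a product of conjugates of y. Moreover h y and h (z y) are
    mutually inverse conjugates of y, so one of them exceeds 1; neither is y,
    because either equality would give z y = y. So every such y wanders
    ([anti_invariant_wandering]).

    Otherwise G is elementary abelian and K is generated by three quadratic
    fields. Take a unit y = A B C with A, B, C > 1, one in each quadratic
    field, each sent to its inverse by the nontrivial automorphism of its
    field, and such that A < B C, B < A C and C < A B. The conjugates of y
    beyond 1 are then A B C, A B / C, A C / B and B C / A, whose product is
    A^2 B^2 C^2 = y^2. Hence M(y) = y^2, and the squares of A, B, C satisfy
    the same conditions ([mahler_triangle_units]). The triangle inequalities
    are reached by replacing each of A, B, C with a suitable power
    ([exists_triangle_units]).

    Both constructions start from a unit eta with |eta| >= 1 and |s eta| < 1
    for every s <> 1 in G ([dominant_unit]), a piece of the Dirichlet unit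
    theorem: in the first case y is the square of eta / z eta, in the second
    the units A, B, C are squares of partial norms of eta. The unit eta is
    obtained by two applications of the pigeonhole principle. The first
    provides lattice points of bounded norm that are small at every place but
    one, the second finds two of them that are congruent modulo a common
    multiple of all the possible norms; their quotient is then a unit. *)

(** * Mahler measure and Galois conjugates *)

Section GaloisConjugates.

Variables (K : splittingFieldType rat) (iota : {rmorphism K -> algC}).
Hypothesis galK : galois 1 {:K}.

Local Notation G := (gal_of {:K}).

Lemma gal_full : 'Gal({:K} / 1)%g = [set: G].
Proof.
by apply/setP=> s; rewrite inE gal_kHom ?sub1v // k1AHom.
Qed.

Lemma card_gal_full : #|{: G}| = \dim {:K}.
Proof. by rewrite -cardsT -gal_full -(galois_dim galK) dimv1 divn1. Qed.

Lemma gal_comp (s t : G) (x : K) : t (s x) = (s * t)%g x.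
Proof. by rewrite galM ?memvf. Qed.

Lemma map_ratr_alg (f : {rmorphism K -> algC}) (p : {poly rat}) :
  map_poly ratr p = map_poly f (map_poly (in_alg K) p).
Proof.
rewrite -map_poly_comp; apply: eq_map_poly => a /=.
by rewrite alg_num_field fmorph_rat.
Qed.

Lemma gal_rat_root (s : G) (p : {poly rat}) (x : K) :
  root (map_poly ratr p) (iota x) -> root (map_poly ratr p) (iota (s x)).
Proof.
rewrite {1}(map_ratr_alg iota) (map_ratr_alg (iota \o s)) fmorph_root.
by rewrite -[iota (s x)]/((iota \o s) x) fmorph_root.
Qed.

Lemma minCpoly_gal (s : G) (x : K) : minCpoly (iota (s x)) = minCpoly (iota x).
Proof.
have [p [Dp mon_p] dv_p] := minCpolyP (iota x).
have [q [Dq mon_q] dv_q] := minCpolyP (iota (s x)).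
rewrite Dp Dq; congr map_poly; apply/eqP.
rewrite -eqp_monic // /eqp -dv_q -dv_p.
have rp : root (map_poly ratr p) (iota x) by rewrite -Dp root_minCpoly.
have rq : root (map_poly ratr q) (iota (s x)) by rewrite -Dq root_minCpoly.
apply/andP; split; first exact: gal_rat_root.
by move: (gal_rat_root s^-1%g rq); rewrite gal_comp mulgV gal_id.
Qed.

Lemma Aint_gal (s : G) (x : K) : iota x \in Aint -> iota (s x) \in Aint.
Proof. by rewrite !unfold_in minCpoly_gal. Qed.

Lemma Crat_base_field (x : K) : x \in 1%VS -> iota x \in Crat.
Proof. by case/vlineP=> a ->; rewrite rmorphZ_num rmorph1 mulr1 Crat_rat. Qed.

(** The Galois factorization of the minimal polynomial over the base field is
    carried to the complex minimal polynomial: both are monic rational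
    polynomials that divide each other. *)
Lemma minCpoly_conjugates (x : K) :
  minCpoly (iota x) =
    \prod_(y <- undup [seq s x | s : G]) ('X - (iota y)%:P).
Proof.
have /(galois_factors (sub1v _))/(_ x (memvf x))[r /= [_ uniq_r Dr]] := galK.
have [p [Dp mon_p] dv_p] := minCpolyP (iota x).
have [q Dq] : exists q, minPoly 1 x = map_poly (in_alg K) q.
  by apply/polyOver1P/minPolyOver.
have mq : map_poly iota (minPoly 1 x) = map_poly ratr q.
  by rewrite Dq -map_ratr_alg.
have Dm : minCpoly (iota x) = map_poly iota (minPoly 1 x).
  rewrite mq Dp; congr map_poly; apply/eqP; rewrite -eqp_monic //; last first.
    by rewrite -(map_monic (in_alg K)) -Dq monic_minPoly.
  rewrite /eqp -dv_p -mq fmorph_root root_minPoly /=.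
  rewrite -(dvdp_map (in_alg K)) -Dq minPoly_dvdp //.
    by apply/polyOver1P; exists p.
  have: root (map_poly ratr p) (iota x) by rewrite -Dp root_minCpoly.
  by rewrite (map_ratr_alg iota) fmorph_root.
rewrite Dm Dr rmorph_prod /= big_map.
have perm_r : perm_eq [seq (s : G) x | s <- r] (undup [seq s x | s : G]).
  apply: uniq_perm; rewrite ?undup_uniq // => y; rewrite mem_undup.
  apply/idP/idP.
    by case/mapP=> s _ ->; apply: image_f.
  case/imageP=> s _ ->; rewrite -root_prod_XsubC -Dr -(fmorph_root iota) -Dm.
  by rewrite -(minCpoly_gal s) root_minCpoly.
rewrite -(perm_big _ perm_r) /= big_map; apply: eq_bigr => s _.
by rewrite rmorphB /= map_polyX map_polyC.
Qed.

(** The leading coefficient in the Mahler measure disappears because [x] is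
    integral, and a Galois extension contains all conjugates of [x]. *)
Lemma mahler_conjugates (x : K) : iota x \in Aint ->
  mahler (iota x) =
    \prod_(y <- undup [seq s x | s : G]) Num.max 1 `|iota y|.
Proof.
move=> int_x; have [c1 lead_gt0 _ Dm] := minZpolyP (iota x).
have [q Dq] : {q | minCpoly (iota x) = map_poly intr q}
  by apply/floorpP; move: int_x; rewrite unfold_in.
have lead1 : lead_coef (minZpoly (iota x)) = 1.
  have: minZpoly (iota x) = lead_coef (minZpoly (iota x)) *: q.
    apply: (@map_inj_poly int algC intr) => //; first exact: intr_inj.
    by rewrite Dm Dq map_polyZ.
  have mon_q : q \is monic.
    apply/monicP/(@intr_inj algC).
    rewrite -lead_coef_map_inj -?Dq ?(monicP (minCpoly_monic _)) //.
    exact: intr_inj.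
  by move/(congr1 zcontents); rewrite c1 zcontentsZ zcontents_monic // mulr1.
rewrite /mahler Dm lead1 scale1r (monicP (minCpoly_monic _)) normr1 mul1r.
rewrite /algC_roots; case: closed_field_poly_normal => s /=.
rewrite (monicP (minCpoly_monic _)) scale1r => Ds.
rewrite -[RHS](big_map iota xpredT (fun z => Num.max 1 `|z|)).
apply/perm_big/prod_XsubC_eq; rewrite -Ds minCpoly_conjugates.
by rewrite big_map.
Qed.

End GaloisConjugates.

(** * A unit that is small at all places but one *)

(** If d clears the denominators of the monic minimal polynomial of z, of
    degree n, then d z is a root of the polynomial whose coefficient of degree
    i is d^(n - i) times the original one: it is monic and integral. *)
Lemma clear_denominator (z : algC) :
  exists2 d : int, d != 0 & d%:~R * z \in Aint.
Proof.
have [p [Dp mon_p] _] := minCpolyP z.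
have [q [d nz_d Dq]] := rat_poly_scale p.
exists d => //; set n := (size p).-1.
have size_p : size p = n.+1 by rewrite prednK // size_poly_gt0 monic_neq0.
have int_dp i : d%:~R * p`_i = (q`_i)%:~R.
  by rewrite Dq coefZ coef_map /= mulrA divff ?mul1r // intr_eq0.
pose f : {poly algC} := \poly_(i < n.+1) (d%:~R ^+ (n - i) * ratr p`_i).
have fn : f`_n = 1.
  by rewrite coef_poly ltnSn subnn mul1r /n -lead_coefE (monicP mon_p) rmorph1.
have size_f : size f = n.+1.
  apply/eqP; rewrite eqn_leq size_poly ltnNge; apply/negP=> /leq_sizeP.
  by move/(_ n (leqnn n))/eqP; rewrite fn oner_eq0.
apply: (@root_monic_Aint f).
- rewrite /root horner_poly; apply/eqP.
  transitivity (d%:~R ^+ n * (minCpoly z).[z]); last first.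
    by rewrite (rootP (root_minCpoly z)) mulr0.
  rewrite Dp horner_coef size_map_poly size_p mulr_sumr; apply: eq_bigr => i _.
  have le_in : (i <= n)%N by rewrite -ltnS.
  have -> : d%:~R ^+ n = d%:~R ^+ (n - i) * d%:~R ^+ i :> algC.
    by rewrite -exprD subnK.
  by rewrite coef_map /= exprMn; ring.
- by rewrite monicE lead_coefE size_f fn.
apply/polyOverP=> i; rewrite coef_poly ltnS.
case: (ltngtP i n) => [lt_in||->]; [|by rewrite rpred0|]; last first.
  by rewrite subnn mul1r /n -lead_coefE (monicP mon_p) rmorph1 rpred1.
rewrite -(prednK (_ : 0 < n - i)%N) ?subn_gt0 // exprSr -mulrA.
rewrite -(ratr_int _ d) -rmorphM /= int_dp ratr_int.
by rewrite rpredM ?rpredX ?intr_int // ratr_int intr_int.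
Qed.

Lemma bounded_family (I : finType) (f : I -> algC) :
  exists C : nat, forall i, `|f i| < C%:R.
Proof.
exists (\sum_i Num.truncn `|f i|).+1 => i.
apply: lt_le_trans (real_truncnS_gt (normr_real _)) _.
by rewrite ler_nat ltnS (bigD1 i) //= leq_addr.
Qed.

(** The index type is that of residues modulo D when D > 0, written so as to
    be inhabited for every D. *)
Definition residue (I : finType) (D : nat) (c : {ffun I -> int}) :
    {ffun I -> 'I_D.-1.+1} :=
  [ffun i => inord `|(c i %% D%:Z)%Z|%N].

Lemma residue_eq (I : finType) (D : nat) (c d : {ffun I -> int}) :
    (0 < D)%N -> residue D c = residue D d ->
  exists e : {ffun I -> int}, c - d = [ffun i => D%:Z * e i].
Proof.
move=> D_gt0 /ffunP eq_cd; exists [ffun i => ((c - d) i %/ D%:Z)%Z].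
apply/ffunP=> i; rewrite [RHS]ffunE [X in _ * X]ffunE [RHS]mulrC divzK //.
have nzD : D%:Z != 0 by rewrite eqz_nat -lt0n.
have resE (a : int) :
    (inord `|(a %% D%:Z)%Z|%N : 'I_D.-1.+1)%:Z = (a %% D%:Z)%Z.
  rewrite inordK ?gez0_abs ?modz_ge0 // prednK //.
  by rewrite -ltz_nat gez0_abs ?modz_ge0 // ltz_pmod // ltz_nat.
rewrite !ffunE -eqz_mod_dvd; apply/eqP; rewrite -(resE (c i)) -(resE (d i)).
by move: (eq_cd i); rewrite !ffunE => ->.
Qed.

Section Dirichlet.

Variables (K : splittingFieldType rat) (iota : {rmorphism K -> algC}).
Hypothesis galK : galois 1 {:K}.
Hypothesis realK : totally_real K.

Local Notation G := (gal_of {:K}).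
Local Notation n := (\dim {:K}).

Lemma real_gal (s : G) (x : K) : iota (s x) \is Num.real.
Proof. exact: (realK (iota \o s)). Qed.

Lemma integral_basis : exists w : 'I_n -> K,
  (forall i, iota (w i) \in Aint) /\
  (forall c : 'I_n -> int, \sum_i (c i)%:~R * w i = 0 -> forall i, c i = 0).
Proof.
pose X := vbasis {:K}.
have /fin_all_exists2[d nz_d int_d] (i : 'I_n) :
    exists2 d : int, d != 0 & d%:~R * iota X`_i \in Aint.
  exact: clear_denominator.
exists (fun i : 'I_n => (d i)%:~R * X`_i); split=> [i|c c0 i].
  by rewrite rmorphM rmorph_int.
(* An integral relation between the scaled vectors is a rational relation
   between the original ones, with coefficients c j * d j. *)
have /freeP/(_ (fun j => (c j * d j)%:~R)) := basis_free (vbasisP {:K}).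
move/(_ _ i) => /(_ _)/eqP; rewrite intr_eq0 mulf_eq0 (negPf (nz_d i)) orbF => e.
apply/eqP/e; rewrite -[RHS]c0; apply: eq_bigr => j _.
by rewrite scaler_int -mulrzl intrM mulrA.
Qed.

(** The norm from K to the rationals, kept as an element of K. *)
Definition conjugate_product (x : K) := \prod_(s : G) s x.

Lemma conjugate_product_int (x : K) : iota x \in Aint ->
  iota (conjugate_product x) \in Num.int.
Proof.
move=> int_x; apply: Cint_rat_Aint.
  apply: Crat_base_field; rewrite (_ : conjugate_product x = galNorm 1 {:K} x).
    by apply: mem_galNorm; rewrite ?memvf.
  by apply: eq_bigl => s; rewrite gal_full inE.
by rewrite rmorph_prod rpred_prod // => s _; apply: Aint_gal.
Qed.

Lemma conjugate_product_eq0 (x : K) : (conjugate_product x == 0) = (x == 0).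
Proof.
apply/idP/idP=> [|/eqP->]; last first.
  by rewrite /conjugate_product (bigD1 1%g) //= gal_id mul0r.
by rewrite prodf_seq_eq0 => /hasP[s _]; rewrite fmorph_eq0.
Qed.

Section Lattice.

Variable w : 'I_n -> K.
Hypothesis w_int : forall i, iota (w i) \in Aint.
Hypothesis w_free :
  forall c : 'I_n -> int, \sum_i (c i)%:~R * w i = 0 -> forall i, c i = 0.

Local Notation vec := {ffun 'I_n -> int}.

Definition lattice_elt (c : vec) : K := \sum_i (c i)%:~R * w i.

Lemma lattice_elt_int c : iota (lattice_elt c) \in Aint.
Proof.
rewrite rmorph_sum rpred_sum // => i _.
by rewrite rmorphM rmorph_int rpredM ?Aint_int.
Qed.

Lemma lattice_elt_eq0 c : (lattice_elt c == 0) = (c == 0).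
Proof.
apply/eqP/eqP=> [/w_free c0|->]; first by apply/ffunP=> i; rewrite c0 ffunE.
by rewrite /lattice_elt big1 // => i _; rewrite ffunE mul0r.
Qed.

Lemma lattice_eltB c d : lattice_elt (c - d) = lattice_elt c - lattice_elt d.
Proof.
rewrite /lattice_elt -sumrB; apply: eq_bigr => i _.
by rewrite !ffunE rmorphB mulrBl.
Qed.

Lemma lattice_eltZ (a : int) (c : vec) :
  lattice_elt [ffun i => a * c i] = a%:~R * lattice_elt c.
Proof.
rewrite /lattice_elt mulr_sumr; apply: eq_bigr => i _.
by rewrite ffunE intrM mulrA.
Qed.

Lemma dim_gt0 : (0 < n)%N.
Proof. by rewrite -(card_gal_full galK); apply/card_gt0P; exists 1%g. Qed.

(** Pigeonhole in the style of Dirichlet. Vectors with coordinates in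
    [0, t^(n - 1)] outnumber the ways of sorting their n - 1 conjugates at the
    places s <> 1 into t^n buckets each, so two of them share all buckets. All
    conjugates are bounded by a multiple of t^(n - 1), so that the buckets
    have width of order 1 / t, and the loss at the identity is compensated by
    the gain at the other places: the norm of the difference is bounded
    independently of t. *)
Lemma conjugate_box : exists M : nat, forall t : nat, (0 < t)%N ->
  exists2 c : vec, c != 0 &
    `|iota (lattice_elt c)| <= M%:R * t%:R ^+ n.-1 /\
    forall s : G, s != 1%g -> `|iota (s (lattice_elt c))| * t%:R <= M%:R.
Proof.
have [C ltC] := bounded_family (fun p : G * 'I_n => iota (p.1 (w p.2))).
pose M := (2 * (n * C))%N; exists M => t t_gt0.
have C_gt0 : (0 < C)%N.
  by have:= ltC (1%g, Ordinal dim_gt0); rewrite -(ltr0n algC); apply: le_lt_trans.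
have M_gt0 : (0 : algC) < M%:R by rewrite ltr0n !muln_gt0 dim_gt0.
pose A := (t ^ n.-1)%N.
have A_gt0 : (0 : algC) < A%:R by rewrite ltr0n expn_gt0 t_gt0.
have elt_bound (s : G) (c : vec) : (forall i, `|c i|%N <= A)%N ->
    `|iota (s (lattice_elt c))| < (n * C)%:R * A%:R.
  move=> le_c; rewrite !rmorph_sum /=.
  apply: le_lt_trans (ler_norm_sum _ _ _) _.
  have -> : (n * C)%:R * A%:R = \sum_(i < n) (A%:R * C%:R) :> algC.
    by rewrite sumr_const card_ord -mulr_natl natrM; ring.
  apply: ltr_sum => [|i _].
    by apply/hasP; exists (Ordinal dim_gt0); rewrite ?mem_index_enum.
  rewrite !rmorphM !rmorph_int normrM.
  apply: (@le_lt_trans _ _ (A%:R * `|iota (s (w i))|)); last first.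
    by rewrite ltr_pM2l // (ltC (s, i)).
  by rewrite ler_wpM2r // -intr_norm -abszE ler_nat.
pose vec_of (a : {ffun 'I_n -> 'I_A.+1}) : vec := [ffun i => (a i)%:Z].
(* The shift by n C A makes the values nonnegative, so that the integer part
   sorts them into t^n buckets. *)
pose bucket (s : G) a : algC :=
  t%:R * (iota (s (lattice_elt (vec_of a))) + (n * C)%:R * A%:R) / M%:R.
have vec_of_le a i : (`|vec_of a i|%N <= A)%N by rewrite ffunE /= -ltnS.
have bucket_itv s a : 0 <= bucket s a < (t ^ n)%:R.
  have := elt_bound s _ (vec_of_le a).
  rewrite real_ltr_norml ?real_gal // => /andP[lo hi].
  have ge0 : 0 <= iota (s (lattice_elt (vec_of a))) + (n * C)%:R * A%:R.
    by rewrite -lerBlDr sub0r ltW.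
  rewrite /bucket !mulr_ge0 ?invr_ge0 ?ler0n //= ltr_pdivrMr //.
  have -> : (t ^ n)%:R = t%:R * A%:R :> algC.
    by rewrite -natrM -expnS prednK // dim_gt0.
  rewrite -mulrA ltr_pM2l ?ltr0n //.
  have -> : A%:R * M%:R = (n * C)%:R * A%:R + (n * C)%:R * A%:R :> algC.
    by rewrite /M natrM; ring.
  by rewrite ltrD2r.
pose Other := {s : G | s != 1%g}.
pose f a : {ffun Other -> 'I_(t ^ n).-1.+1} :=
  [ffun s => inord (Num.truncn (bucket (val s) a))].
have /injectivePn[a [b neq_ab eq_ab]] : ~~ injectiveb f.
  apply/injectiveP=> /leq_card; rewrite !card_ffun !card_ord card_sig.
  rewrite prednK ?expn_gt0 ?t_gt0 // leqNgt => /negP; apply.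
  have -> : #|[pred s : G | s != 1%g]| = n.-1.
    by rewrite -(card_gal_full galK) (cardC1 (1%g : G)).
  (* (t^n)^(n-1) = A^n < (A+1)^n *)
  rewrite -expnM mulnC expnM -/A ltn_exp2r ?dim_gt0 //.
exists (vec_of a - vec_of b).
  apply: contraNneq neq_ab => /ffunP e; apply/eqP/ffunP=> i.
  by have := e i; rewrite !ffunE => /eqP; rewrite subr_eq0 => /eqP[] /ord_inj.
split.
  rewrite -[X in iota X](gal_id {:K}%AS).
  apply: le_trans (ltW (elt_bound _ _ _)) _ => [i|].
    rewrite !ffunE; have:= ltn_ord (b i); have := ltn_ord (a i); rewrite !ltnS.
    by clearbody A; move: (nat_of_ord (a i)) (nat_of_ord (b i)) => x y; lia.
  by rewrite /A natrX ler_wpM2r ?exprn_ge0 ?ler0n // ler_nat leq_pmull.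
move=> s nz_s.
have /ffunP/(_ (exist _ s nz_s)) := eq_ab; rewrite !ffunE /= => /(congr1 val).
have trE c : (inord (Num.truncn (bucket s c)) : 'I_(t ^ n).-1.+1)
    = Num.truncn (bucket s c) :> nat.
  have /andP[ge0 lt] := bucket_itv s c.
  by rewrite /= inordK // prednK ?expn_gt0 ?t_gt0 // truncn_lt_nat.
rewrite /= !trE; set k := Num.truncn (bucket s b) => eq_tr.
have /andP[/truncn_itv/andP[lo_a hi_a] _] := bucket_itv s a.
have /andP[/truncn_itv/andP[lo_b hi_b] _] := bucket_itv s b.
rewrite eq_tr in lo_a hi_a; rewrite -/k in lo_b hi_b.
have : `|bucket s a - bucket s b| <= 1.
  have -> : 1 = k.+1%:R - k%:R :> algC by rewrite -natr1 addrC addKr.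
  rewrite real_ler_norml.
    rewrite lerNl opprB.
    apply/andP; split; first exact: lerB (ltW hi_b) lo_a.
    exact: lerB (ltW hi_a) lo_b.
  have [/andP[ge0a _] /andP[ge0b _]] := (bucket_itv s a, bucket_itv s b).
  by rewrite realB // ger0_real.
have -> : bucket s a - bucket s b =
    iota (s (lattice_elt (vec_of a - vec_of b))) * t%:R / M%:R.
  by rewrite lattice_eltB !rmorphB /= /bucket; field; rewrite gt_eqF.
by rewrite !normrM normfV !normr_nat ler_pdivrMr // mul1r.
Qed.

(** Taking t large in the previous bound beats any given nonzero x at all the
    places s <> 1. *)
Lemma small_lattice_elt : exists B : nat, forall x : K, x != 0 ->
  exists c : vec, [/\ c != 0, `|iota (conjugate_product (lattice_elt c))| <= B%:R &
    forall s : G, s != 1%g -> `|iota (s (lattice_elt c))| < `|iota (s x)| ].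
Proof.
have [M box] := conjugate_box; exists (M ^ n)%N => x nz_x.
have [u lt_u] := bounded_family (fun s : G => M%:R / iota (s x)).
have u_gt0 : (0 < u)%N.
  by have := lt_u 1%g; rewrite -(ltr0n algC); apply: le_lt_trans.
have [c nz_c [le1 leM]] := box u u_gt0.
have u_gt0' : (0 : algC) < u%:R by rewrite ltr0n.
exists c; split=> // [|s nz_s].
  rewrite rmorph_prod normr_prod (bigD1 1%g) //= gal_id.
  apply: (@le_trans _ _ (M%:R * u%:R ^+ n.-1 * (M%:R / u%:R) ^+ n.-1)); last first.
    rewrite -mulrA -exprMn mulrCA divff ?gt_eqF // mulr1 -exprS.
    by rewrite prednK ?dim_gt0 // natrX.
  apply: ler_pM => //; first exact: prodr_ge0.
  have <- : #|[pred s : G | s != 1%g]| = n.-1.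
    by rewrite -(card_gal_full galK) (cardC1 (1%g : G)).
  rewrite -prodr_const; apply: ler_prod => s nz_s.
  by rewrite normr_ge0 ler_pdivlMr //= leM.
have sx_gt0 : 0 < `|iota (s x)| by rewrite normr_gt0 !fmorph_eq0.
have := lt_u s; rewrite normrM normfV normr_nat ltr_pdivrMr // => lt_s.
rewrite -(ltr_pM2r u_gt0'); apply: le_lt_trans (leM s nz_s) _.
by rewrite mulrC.
Qed.

(** The norm of the denominator d divides D, and its cofactor is the product
    of the other conjugates, which is integral. Therefore D / d is integral
    and so is c / d = 1 + (D / d) e. *)
Lemma lattice_quotient_int (B D : nat) (c d e : vec) :
    (forall m, 0 < m <= B -> m %| D)%N ->
    d != 0 -> `|iota (conjugate_product (lattice_elt d))| <= B%:R ->
    c - d = [ffun i => D%:Z * e i] ->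
  iota (lattice_elt c / lattice_elt d) \in Aint.
Proof.
move=> dvdD nz_d le_d Dcd.
have nz_dK : lattice_elt d != 0 by rewrite lattice_elt_eq0.
set x := lattice_elt d in nz_dK le_d *.
have int_x : iota x \in Aint by apply: lattice_elt_int.
have nz_Nx : conjugate_product x != 0 by rewrite conjugate_product_eq0.
have /intrP[N DN] := conjugate_product_int int_x.
have nz_N : N != 0 by rewrite -(intr_eq0 algC) -DN fmorph_eq0.
have /dvdnP[m Dm] : (`|N| %| D)%N.
  apply: dvdD; rewrite absz_gt0 nz_N /=.
  by move: le_d; rewrite DN -intr_norm -abszE ler_nat.
have DNK : conjugate_product x = N%:~R.
  by apply: (fmorph_inj iota); rewrite DN rmorph_int.
pose y := \prod_(s : G | s != 1%g) s x.
have DNx : conjugate_product x = x * y.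
  by rewrite /conjugate_product (bigD1 1%g) //= gal_id.
have -> : lattice_elt c / x = 1 + m%:Z%:~R * (sgz N)%:~R * y * lattice_elt e.
  have -> : lattice_elt c = x + lattice_elt (c - d).
    by rewrite lattice_eltB addrC subrK.
  rewrite Dcd lattice_eltZ mulrDl divff //; congr (_ + _).
  have -> : (D%:Z)%:~R = m%:Z%:~R * (sgz N)%:~R * conjugate_product x.
    rewrite Dm DNK PoszM abszEsg !intrM; ring.
  by rewrite DNx; field.
rewrite rmorphD rmorph1 rpredD ?Aint1 // !rmorphM !rmorph_int.
rewrite !rpredM ?Aint_int ?lattice_elt_int //.
by rewrite rmorph_prod rpred_prod // => s _; apply: Aint_gal.
Qed.

End Lattice.

(** Iterating [small_lattice_elt] gives arbitrarily long lists of nonzero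
    lattice points of bounded norm, each smaller than the next at all the
    places s <> 1. In a long enough list two of them are congruent modulo
    a common multiple D of the norms, so both quotients are integral. At the
    remaining place the unit is at least 1 because its norm is a nonzero
    integer. *)
Theorem dominant_unit : exists eta : K,
  [/\ iota eta \in Aint, iota eta^-1 \in Aint, 1 <= `|iota eta| &
      forall s : G, s != 1%g -> `|iota (s eta)| < 1].
Proof.
have [w [w_int w_free]] := integral_basis.
pose L := lattice_elt w.
have [B small] := small_lattice_elt w.
pose good c := (c != 0) && (`|iota (conjugate_product (L c))| <= B%:R).
pose dom c d :=
  [forall s : G, (s != 1%g) ==> (`|iota (s (L c))| < `|iota (s (L d))|)].
have dom_tr : transitive dom.
  move=> d c e /forallP cd /forallP de; apply/forallP=> s; apply/implyP=> nz_s.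
  exact: lt_trans (implyP (cd s) nz_s) (implyP (de s) nz_s).
have chain k : exists s, [/\ size s = k, all good s & sorted dom s].
  elim: k => [|k [[|d s] [size_s good_s dom_s]]]; first by exists [::].
    have [|c [nz_c le_c _]] := small 1; first exact: oner_neq0.
    by exists [:: c]; rewrite /= /good nz_c le_c -size_s.
  have /andP[nz_d _] : good d by case/andP: good_s.
  have [|c [nz_c le_c lt_c]] := small (L d); first by rewrite lattice_elt_eq0.
  exists [:: c, d & s]; split; first by rewrite /= -size_s.
    by rewrite /= in good_s *; rewrite good_s andbT /good nz_c.
  by rewrite /= in dom_s *; rewrite dom_s andbT; apply/forallP=> t; apply/implyP/lt_c.
have [D D_gt0 dvdD] :
    exists2 D, (0 < D)%N & forall m, (0 < m <= B -> m %| D)%N.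
  by exists B`!; [apply: fact_gt0 | move=> m; apply: dvdn_fact].
have [s [size_s good_s sorted_s]] :=
  chain #|{: {ffun 'I_n -> 'I_D.-1.+1}}|.+1.
have /(uniqPn [ffun=> ord0])[i [j [lt_ij lt_js eq_ij]]] : ~~ uniq (map (residue D) s).
  apply/negP=> /card_uniqP; rewrite size_map size_s => e.
  by have := max_card (mem (map (residue D) s)); rewrite e ltnn.
rewrite size_map in lt_js; have lt_is := ltn_trans lt_ij lt_js.
rewrite !(nth_map 0) // in eq_ij.
set c := nth 0 s i in eq_ij; set d := nth 0 s j in eq_ij.
have /andP[nz_c le_c] : good c by apply/(allP good_s)/mem_nth.
have /andP[nz_d le_d] : good d by apply/(allP good_s)/mem_nth.
have /forallP dom_cd : dom c d by apply: (sorted_ltn_nth dom_tr) => //; rewrite inE.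
have [e De] := residue_eq D_gt0 eq_ij.
have [e' De'] := residue_eq D_gt0 (esym eq_ij).
pose eta := L c / L d.
have nz_eta : eta != 0 by rewrite mulf_neq0 ?invr_eq0 ?lattice_elt_eq0.
have int_eta : iota eta \in Aint by apply: lattice_quotient_int dvdD _ le_d De.
have lt_eta (t : G) : t != 1%g -> `|iota (t eta)| < 1.
  move=> nz_t; rewrite !fmorph_div normrM normfV ltr_pdivrMr ?mul1r.
    by have /implyP-> := dom_cd t.
  by rewrite normr_gt0 !fmorph_eq0 lattice_elt_eq0.
exists eta; split=> //.
  by rewrite invf_div; apply: lattice_quotient_int dvdD _ le_c De'.
have /intrP[N DN] := conjugate_product_int int_eta.
have : 1 <= `|iota (conjugate_product eta)|.
  rewrite DN -intr_norm -abszE ler1n absz_gt0 -(intr_eq0 algC) -DN fmorph_eq0.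
  by rewrite conjugate_product_eq0.
rewrite rmorph_prod normr_prod (bigD1 1%g) //= gal_id => /le_trans; apply.
rewrite ler_piMr // prodr_ile1 // => t nz_t.
by rewrite normr_ge0 ltW ?lt_eta.
Qed.

End Dirichlet.

(** * Iteration of the Mahler measure *)

Lemma wandering_increasing (x : algC) :
  (forall k, iter k mahler x < iter k.+1 mahler x) -> wandering x.
Proof.
move=> lt_iter /cardinality.finite_seqP[s Ds].
have lt_it : {homo (fun k => iter k mahler x) : i j / (i < j)%N >-> i < j}.
  by apply: homo_ltn lt_iter => b a c; apply: lt_trans.
have inj_it : injective (fun k => iter k mahler x).
  move=> i j /= eq_ij; case: (ltngtP i j) => // /lt_it.
    by rewrite eq_ij ltxx.
  by rewrite eq_ij ltxx.
have /uniq_leq_size : uniq [seq iter k mahler x | k <- iota 0 (size s).+1].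
  by rewrite map_inj_uniq ?iota_uniq.
move/(_ s); rewrite size_map size_iota ltnn => H; apply: notF; apply: H.
move=> _ /mapP[k _ ->].
have : mahler_orbit x (iter k mahler x) by exists k.
by rewrite Ds.
Qed.

Lemma prodr_ge1 (I : Type) (r : seq I) (P : pred I) (F : I -> algC) :
  (forall i, P i -> 1 <= F i) -> 1 <= \prod_(i <- r | P i) F i.
Proof. by move=> ge1; elim/big_ind: _ => // x y; apply: mulr_ege1. Qed.

(** The absolute values of the conjugates of A B C in a compositum of three
    quadratic fields, one for each choice of signs of the exponents. *)
Definition signed_product (a b c : algC) (p : bool * bool * bool) : algC :=
  (if p.1.1 then a^-1 else a) * (if p.1.2 then b^-1 else b)
    * (if p.2 then c^-1 else c).

Section SignedProduct.

Variables a b c : algC.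
Hypotheses (gt1a : 1 < a) (gt1b : 1 < b) (gt1c : 1 < c).

Local Notation F := (signed_product a b c).

Let a_gt0 : 0 < a := lt_trans ltr01 gt1a.
Let b_gt0 : 0 < b := lt_trans ltr01 gt1b.
Let c_gt0 : 0 < c := lt_trans ltr01 gt1c.

Lemma signed_product_gt0 p : 0 < F p.
Proof. by rewrite /signed_product !mulr_gt0 //; case: ifP; rewrite ?invr_gt0. Qed.

Lemma signed_product_lt p : p != (false, false, false) ->
  F p < F (false, false, false).
Proof.
have V_lt (x : algC) : 1 < x -> x^-1 < x.
  by move=> gt1x; apply: (lt_trans _ gt1x); rewrite invf_lt1 // (lt_trans ltr01).
have sg_le (e : bool) (x : algC) : 1 < x -> 0 < (if e then x^-1 else x) <= x.
  move=> gt1x; have x_gt0 := lt_trans ltr01 gt1x.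
  by case: e; rewrite /= ?invr_gt0 x_gt0 ?lexx ?ltW ?V_lt.
move: p => [[ea eb] ec]; rewrite /signed_product /=.
have /andP[sb_gt0 le_b] := sg_le eb b gt1b.
have /andP[sc_gt0 le_c] := sg_le ec c gt1c.
case: ea => [_|].
  apply: (@lt_le_trans _ _ (a * (if eb then b^-1 else b) * (if ec then c^-1 else c))).
    by rewrite !ltr_pM2r ?V_lt.
  by rewrite ler_pM ?mulr_ge0 ?(ltW sb_gt0) ?(ltW sc_gt0) ?(ltW a_gt0) // ler_pM2l.
case: eb le_b sb_gt0 => [_ _ _|_ _].
  apply: (@lt_le_trans _ _ (a * b * (if ec then c^-1 else c))).
    by rewrite ltr_pM2r // ltr_pM2l ?V_lt.
  by rewrite ler_pM2l ?mulr_gt0.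
by case: ec sc_gt0 le_c => // _ _ _; rewrite ltr_pM2l ?mulr_gt0 ?V_lt.
Qed.

Hypotheses (lta : a < b * c) (ltb : b < a * c) (ltc : c < a * b).

(** The four factors beyond 1 are those with at most one inverse. *)
Lemma prod_max_signed_product :
  \prod_p Num.max 1 (F p) = a ^+ 2 * b ^+ 2 * c ^+ 2.
Proof.
transitivity (\prod_p1 \prod_p2 \prod_p3 Num.max 1 (F (p1, p2, p3))).
  by rewrite !pair_bigA /=; apply: eq_bigr => -[[p1 p2] p3] _ /=.
rewrite !big_bool.
have maxV p : F p < 1 -> Num.max 1 (F p) = 1.
  by move/ltW/max_l.
have maxF p : 1 < F p -> Num.max 1 (F p) = F p.
  by move/ltW/max_r.
rewrite (maxV (true, true, true)) ?(maxV (true, true, false)).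
rewrite ?(maxV (true, false, true)) ?(maxV (false, true, true)).
rewrite ?(maxF (true, false, false)) ?(maxF (false, true, false)).
rewrite ?(maxF (false, false, true)) ?(maxF (false, false, false)).
all: rewrite /signed_product /=.
- by field; rewrite !gt_eqF.
- by rewrite !mulr_egt1.
- by rewrite ltr_pdivlMr ?mul1r.
- by rewrite mulrAC ltr_pdivlMr ?mul1r.
- by rewrite -mulrA mulrC ltr_pdivlMr ?mul1r.
- by rewrite !ltr_pdivrMr // mul1r mulrC.
- by rewrite [a^-1 * b]mulrC !ltr_pdivrMr // mul1r mulrC.
- by rewrite mulrC mulrA !ltr_pdivrMr // mul1r mulrC.
by rewrite -!invfM invf_lt1 ?mulr_egt1 ?mulr_gt0.
Qed.

End SignedProduct.

(** By the Bernoulli inequality the powers of x are unbounded. *)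
Lemma power_between (x X : algC) : 1 < x -> 1 <= X ->
  exists n, x ^+ n <= X < x ^+ n.+1.
Proof.
move=> gt1x ge1X; have x_gt0 := lt_trans ltr01 gt1x.
have bernoulli n : 1 + n%:R * (x - 1) <= x ^+ n.
  elim: n => [|n IHn]; first by rewrite mul0r addr0.
  apply: (@le_trans _ _ (x ^+ n + (x - 1))).
    by rewrite -natr1 mulrDl mul1r addrA lerD2r.
  rewrite exprS -lerBrDl -[X in _ <= _ - X]mul1r -mulrBl.
  by rewrite ler_peMr ?exprn_ege1 ?subr_ge0 // ltW.
have real_X : X \is Num.real by rewrite ger0_real ?(le_trans ler01).
have exP : exists n, X < x ^+ n.
  exists (Num.truncn (X / (x - 1))).+1; apply: lt_le_trans (bernoulli _).
  have lt_tr : X / (x - 1) < (Num.truncn (X / (x - 1))).+1%:R.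
    by apply: real_truncnS_gt; rewrite rpred_div // rpredB ?rpred1 // gtr0_real.
  apply: (@lt_trans _ _ ((Num.truncn (X / (x - 1))).+1%:R * (x - 1))).
    by rewrite -ltr_pdivrMr ?subr_gt0.
  by rewrite ltrDr.
case: (ex_minnP exP) => -[|n] lt_X min_n.
  by move: lt_X; rewrite expr0 => /(le_lt_trans ge1X); rewrite ltxx.
exists n; rewrite lt_X andbT real_leNgt ?rpredX ?(gtr0_real x_gt0) //.
by apply/negP=> /min_n; rewrite ltnn.
Qed.

Section TotallyReal.

Variables (K : splittingFieldType rat) (iota : {rmorphism K -> algC}).
Hypothesis galK : galois 1 {:K}.
Hypothesis realK : totally_real K.

Local Notation G := (gal_of {:K}).

Lemma wandering_invariant (P : K -> Prop) (y : K) :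
    (forall y, P y -> exists y',
       [/\ P y', mahler (iota y) = iota y' & iota y < iota y']) ->
  P y -> wandering (iota y).
Proof.
move=> step Py; apply: wandering_increasing => k.
suffices [yk [Pk Dk]] : exists yk, P yk /\ iter k mahler (iota y) = iota yk.
  by have [y' [_ Dy' lt_y]] := step _ Pk; rewrite iterS Dk Dy'.
elim: k => [|k [yk [Pk /= ->]]]; first by exists y.
by have [y' [Py' -> _]] := step _ Pk; exists y'.
Qed.

Definition totally_positive (x : K) := forall s : G, 0 < iota (s x).

Lemma totally_positive_sqr (x : K) : x != 0 -> totally_positive (x ^+ 2).
Proof.
move=> nz_x s; rewrite !rmorphXn /= real_exprn_even_gt0 ?real_gal //.
by rewrite !fmorph_eq0.
Qed.

Section CentralSquare.

Variables h z : G.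
Hypotheses (hh : (h * h = z)%g) (zz : (z * z = 1)%g).
Hypothesis zC : forall s : G, (s * z = z * s)%g.

(** The invariant for groups with an element h of order 4, where z = h^2. *)
Definition anti_invariant (y : K) :=
  [/\ iota y \in Aint, totally_positive y, y * z y = 1 & 1 < iota y].

(** A product of conjugates inherits the relation with z since z is central.
    It grows strictly because h y or h (z y), its inverse, is a second
    conjugate beyond 1: if it were equal to y, then h^2 = z would fix y, which
    is impossible for y > 1 with z y = 1 / y. *)
Lemma anti_invariant_step (y : K) : anti_invariant y ->
  exists y', [/\ anti_invariant y', mahler (iota y) = iota y' & iota y < iota y'].
Proof.
move=> [int_y pos_y yz1 gt1_y].
pose r := undup [seq (s : G) y | s : G].
have rP w : w \in r -> exists s : G, w = s y.
  by rewrite mem_undup => /imageP[s _ ->]; exists s.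
have mem_r (s : G) : s y \in r by rewrite mem_undup image_f.
have uniq_r : uniq r := undup_uniq _.
pose y' := \prod_(w <- r | 1 < iota w) w.
have Dy' : iota y' = \prod_(w <- r) (if 1 < iota w then iota w else 1).
  by rewrite rmorph_prod big_mkcond.
have ge1 w : 1 <= (if 1 < iota w then iota w else 1) by case: ifP => // /ltW.
have [w2 w2_r [w2_neq w2_gt1]] : exists2 w, w \in r & w != y /\ 1 < iota w.
  have nz_y : y != 0 by apply: contraTneq gt1_y => ->; rewrite rmorph0 ltr10.
  have hzy : h y * h (z y) = 1 by rewrite -rmorphM yz1 rmorph1.
  have zy_neq : z y != y.
    apply: contraTneq gt1_y => zy; rewrite zy in yz1.
    apply/negP=> gt1_y; have := mulr_egt1 gt1_y gt1_y.
    by rewrite -rmorphM yz1 rmorph1 ltxx.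
  have hy_neq : h y != y.
    by apply: contraNneq zy_neq => hy; rewrite -hh -gal_comp !hy.
  have hzy_neq : h (z y) != y.
    apply: contraNneq zy_neq => hzy_eq; rewrite hzy_eq in hzy.
    have zy_hy : z y = h y by apply: (mulfI nz_y); rewrite yz1 mulrC.
    by rewrite -hh -gal_comp -zy_hy hzy_eq.
  have [lt1|gt1|eq1] := real_ltgtP (real_gal iota realK h y) (real1 _).
  - exists (h (z y)); first by rewrite gal_comp mem_r.
    split=> //; move: (congr1 iota hzy); rewrite rmorphM rmorph1 => hzy1.
    by rewrite -hzy1 gtr_pMl ?pos_y // gal_comp pos_y.
  - by exists (h y).
  - move: eq1; rewrite -(rmorph1 iota) => /fmorph_inj.
    rewrite -(rmorph1 h) => /fmorph_inj y1.
    by move: gt1_y; rewrite y1 (rmorph1 iota) ltxx.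
exists y'; split.
- split.
  + rewrite rmorph_prod big_seq_cond rpred_prod // => w /andP[/rP[s ->] _].
    exact: Aint_gal.
  + move=> t; rewrite !rmorph_prod big_seq_cond prodr_gt0 // => w.
    by case/andP=> /rP[s ->] _; rewrite /= gal_comp.
  + rewrite rmorph_prod -big_split big_seq_cond big1 // => w.
    case/andP=> /rP[s ->] _ /=.
    by rewrite gal_comp zC -gal_comp -rmorphM yz1 rmorph1.
  rewrite Dy' (big_rem y) /=; last by rewrite -[X in X \in _](gal_id {:K}%AS).
  rewrite gt1_y (lt_le_trans gt1_y) // ler_peMr ?(ltW (lt_trans _ gt1_y)) //.
  by apply: prodr_ge1.
- rewrite mahler_conjugates // -/r Dy' big_seq [RHS]big_seq.
  apply: eq_bigr => w /rP[s ->].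
  by rewrite gtr0_norm // maxEle.
rewrite Dy' (big_rem y) /=; last by rewrite -[X in X \in _](gal_id {:K}%AS).
rewrite gt1_y (big_rem w2) /=; last by rewrite mem_rem_uniq // inE w2_neq.
rewrite w2_gt1 ltr_pMr ?(lt_trans _ gt1_y) //.
rewrite (lt_le_trans w2_gt1) // ler_peMr ?(ltW (lt_trans _ w2_gt1)) //.
exact: prodr_ge1.
Qed.

Lemma algebraic_unit_anti_invariant (y : K) :
  anti_invariant y -> algebraic_unit iota y.
Proof.
by case=> int_y _ yz1 _; split=> //; exists (z y); rewrite ?Aint_gal.
Qed.

Lemma anti_invariant_wandering (y : K) : anti_invariant y -> wandering (iota y).
Proof. exact/wandering_invariant/anti_invariant_step. Qed.

(** The square of eta / z eta: squaring makes it totally positive, and z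
    exchanges numerator and denominator. *)
Lemma exists_anti_invariant : z != 1%g -> exists y, anti_invariant y.
Proof.
move=> nz_z.
have [eta [int_eta int_etaV ge1_eta lt1_eta]] := dominant_unit iota galK realK.
have nz_eta : eta != 0.
  by apply: contraTneq ge1_eta => ->; rewrite rmorph0 normr0 ler10.
exists ((eta / z eta) ^+ 2).
have zzE x : z (z x) = x by rewrite gal_comp zz gal_id.
split.
- by rewrite rmorphXn rpredX // rmorphM rpredM // -rmorphV ?unitfE // Aint_gal.
- by apply: totally_positive_sqr; rewrite mulf_neq0 ?invr_eq0 ?fmorph_eq0.
- rewrite rmorphXn /= fmorph_div /= zzE -exprMn.
  by rewrite mulrA divfK ?fmorph_eq0 // divff // expr1n.
rewrite rmorphXn /= fmorph_div -[X in _ < X]real_normK; last first.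
  by rewrite rpred_div ?real_gal // -[X in iota X](gal_id {:K}%AS) real_gal.
rewrite normrM normfV exprn_egt1 // ltr_pdivlMr ?normr_gt0 ?fmorph_eq0 // mul1r.
exact: lt_le_trans (lt1_eta _ nz_z) ge1_eta.
Qed.

End CentralSquare.

Section ThreeQuadraticFields.

Variables bitA bitB bitC : G -> bool.

(** For a quadratic character c, this says that x lies in the quadratic field
    fixed by the kernel of c and has norm 1 there. *)
Definition sign_conjugate (c : G -> bool) (x : K) :=
  forall s : G, s x = if c s then x^-1 else x.

(** In additive terms log A, log B and log C are the sides of a nondegenerate
    triangle. *)
Definition triangle_units (A B C : K) :=
  [/\ sign_conjugate bitA A, sign_conjugate bitB B & sign_conjugate bitC C] /\
  [/\ iota A \in Aint, iota B \in Aint & iota C \in Aint] /\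
  [/\ 1 < iota A, 1 < iota B & 1 < iota C] /\
  [/\ iota A < iota B * iota C, iota B < iota A * iota C
    & iota C < iota A * iota B].

Hypothesis bits_inj : injective (fun s => (bitA s, bitB s, bitC s)).
Hypothesis card_G : #|{: G}| = 8%N.

Lemma bits_bij : bijective (fun s => (bitA s, bitB s, bitC s)).
Proof. by apply: inj_card_bij bits_inj _; rewrite card_G !card_prod card_bool. Qed.

Lemma sign_conjugateX c x n : sign_conjugate c x -> sign_conjugate c (x ^+ n).
Proof. by move=> cx s; rewrite rmorphXn /= cx; case: ifP; rewrite ?exprVn. Qed.

Lemma sign_conjugate1 c x : sign_conjugate c x -> 1 < iota x -> c 1%g = false.
Proof.
move=> cx gt1x; apply/negP=> c1; have := cx 1%g; rewrite c1 gal_id => xV.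
have x_gt0 : 0 < iota x := lt_trans ltr01 gt1x.
have := mulr_egt1 gt1x gt1x; rewrite {2}xV fmorphV divff ?ltxx //.
by rewrite gt_eqF.
Qed.

(** The eight conjugates of y = A B C are distinct because each of them other
    than y is smaller than y, so the Mahler measure runs over all the sign
    patterns and [prod_max_signed_product] applies. *)
Lemma mahler_triangle_units A B C : triangle_units A B C ->
  mahler (iota (A * B * C)) = iota (A ^+ 2 * B ^+ 2 * C ^+ 2).
Proof.
move=> [[cA cB cC] [[intA intB intC] [[gt1A gt1B gt1C] [ltA ltB ltC]]]].
set y := A * B * C; set a := iota A in gt1A ltA ltB ltC *.
set b := iota B in gt1B ltA ltB ltC *; set c := iota C in gt1C ltA ltB ltC *.
have [a0 b0 c0] : [/\ 0 < a, 0 < b & 0 < c] by split; apply: lt_trans ltr01 _.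
set F := signed_product a b c.
have sy (s : G) : iota (s y) = F (bitA s, bitB s, bitC s).
  rewrite /F /signed_product /y !rmorphM /= cA cB cC.
  by do 3 case: ifP => _; rewrite ?fmorphV.
have bits1 : (bitA 1%g, bitB 1%g, bitC 1%g) = (false, false, false).
  by rewrite (sign_conjugate1 cA gt1A) (sign_conjugate1 cB gt1B)
             (sign_conjugate1 cC gt1C).
have y_inj : injective (fun s : G => s y).
  move=> s t /= eq_st; apply/eqP; rewrite eq_mulgV1; apply/eqP/bits_inj => /=.
  rewrite bits1; apply: contraTeq (lexx (iota y)) => /(signed_product_lt gt1A gt1B gt1C).
  rewrite -/F -sy -gal_comp eq_st.
  by rewrite gal_comp mulgV -bits1 -sy ltxx.
have [f fK Kf] := bits_bij.
rewrite mahler_conjugates ?rmorphM ?rpredM //.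
rewrite undup_id; last by rewrite map_inj_uniq -?enumT ?enum_uniq.
rewrite big_image /=.
under eq_bigr do rewrite sy.
rewrite (reindex f) /=; last first.
  by exists (fun s => (bitA s, bitB s, bitC s)) => ? _; [apply: Kf | apply: fK].
under eq_bigr do rewrite Kf.
under eq_bigr => p _ do rewrite gtr0_norm ?signed_product_gt0 //.
by rewrite prod_max_signed_product // !rmorphM !rmorphXn.
Qed.

Lemma triangle_units_wandering A B C : triangle_units A B C ->
  wandering (iota (A * B * C)).
Proof.
move=> ABC; apply: (@wandering_invariant
  (fun y => exists A B C, triangle_units A B C /\ y = A * B * C)).
  move=> _ [A' [B' [C' [T' ->]]]].
  exists (A' ^+ 2 * B' ^+ 2 * C' ^+ 2); split.
  - exists (A' ^+ 2), (B' ^+ 2), (C' ^+ 2); split=> //.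
    case: T' => [[cA cB cC] [[intA intB intC] [[gt1A gt1B gt1C] [ltA ltB ltC]]]].
    split; first by split; apply: sign_conjugateX.
    rewrite !rmorphXn /=.
    split; first by rewrite !rpredX.
    split; first by rewrite !exprn_egt1.
    split; rewrite -exprMn ltr_pXn2r // nnegrE ?mulr_ge0 // ltW //;
      by rewrite (lt_trans ltr01).
  - exact: mahler_triangle_units.
  case: T' => [_ [_ [[gt1A gt1B gt1C] _]]].
  by rewrite -!exprMn rmorphXn /= ltr_eXnr // !rmorphM /= ?mulr_egt1.
by exists A, B, C.
Qed.

Definition additive_bit (c : G -> bool) :=
  forall s t : G, c (s * t)%g = c s (+) c t.

(** The partial norm p of a dominant unit over the kernel of c, squared. The
    partial norm q over the complement is a nonempty product of conjugates of
    absolute value less than 1, and p^2 q^2 = 1 as the full norm is 1 or -1.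
    An automorphism outside the kernel exchanges p and q. *)
Lemma sign_unit (c : G -> bool) (t : G) : additive_bit c -> c t ->
  exists e : K, [/\ sign_conjugate c e, iota e \in Aint & 1 < iota e].
Proof.
move=> cM ct.
have [eta [int_eta int_etaV ge1_eta lt1_eta]] := dominant_unit iota galK realK.
have nz_eta : eta != 0.
  by apply: contraTneq ge1_eta => ->; rewrite rmorph0 normr0 ler10.
have c1 : c 1%g = false by have := cM 1%g 1%g; rewrite mulg1; case: (c 1%g).
pose p := \prod_(s : G | ~~ c s) s eta.
pose q := \prod_(s : G | c s) s eta.
have Dpq : conjugate_product eta = q * p by rewrite /conjugate_product (bigID c).
have pq1 : p ^+ 2 * q ^+ 2 = 1.
  have /intrP[N DN] := conjugate_product_int galK int_eta.
  have /intrP[N' DN'] := conjugate_product_int galK int_etaV.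
  have NN' : conjugate_product eta * conjugate_product eta^-1 = 1.
    rewrite /conjugate_product -big_split big1 // => s _ /=.
    by rewrite fmorphV divff // fmorph_eq0.
  have /(congr1 absz)/eqP : N * N' = 1.
    by apply: (@intr_inj algC); rewrite intrM -DN -DN' -rmorphM NN' rmorph1.
  rewrite abszM muln_eq1 => /andP[/eqP N1 _].
  rewrite mulrC -exprMn -Dpq; apply: (fmorph_inj iota).
  rewrite rmorphXn /= DN rmorph1 -rmorphXn /= -real_normK ?num_real //.
  by rewrite -abszE N1.
have nz_p : p ^+ 2 != 0.
  by apply/eqP=> p0; move/eqP: pq1; rewrite p0 mul0r eq_sym oner_eq0.
have Dq : q ^+ 2 = (p ^+ 2)^-1 by apply: (mulfI nz_p); rewrite pq1 divff.
have conj_p (u : G) : u p = \prod_(s : G | ~~ (c s (+) c u)) s eta.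
  rewrite rmorph_prod [RHS](reindex_inj (mulIg u)) /=.
  apply: eq_big => [s|s _]; last by rewrite /= gal_comp.
  by rewrite cM -addbA addbb addbF.
exists (p ^+ 2); split.
- move=> u; rewrite rmorphXn /= conj_p; case: ifP => cu; last first.
    by congr (_ ^+ 2); apply: eq_bigl => s; rewrite addbF.
  by rewrite -Dq; congr (_ ^+ 2); apply: eq_bigl => s; rewrite addbT negbK.
- by rewrite rmorphXn rpredX // rmorph_prod rpred_prod // => s _; apply: Aint_gal.
have lt1_q : `|iota q| < 1.
  rewrite rmorph_prod normr_prod (bigD1 t) //=.
  have nz c' : c c' -> c' != 1%g by move=> cc'; apply: contraTneq cc' => ->; rewrite c1.
  apply: le_lt_trans (lt1_eta t (nz t ct)).
  rewrite ler_piMr // prodr_ile1 // => s /andP[cs _].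
  by rewrite normr_ge0 ltW ?lt1_eta ?nz.
have real_q : iota q \is Num.real.
  by rewrite rmorph_prod rpred_prod // => s _; apply: real_gal.
have pq1' : iota (p ^+ 2) * `|iota q| ^+ 2 = 1.
  by rewrite real_normK // -rmorphXn -rmorphM pq1 rmorph1.
have q_gt0 : 0 < `|iota q| ^+ 2.
  rewrite exprn_gt0 // normr_gt0 fmorph_eq0; apply/eqP=> q0; move/eqP: pq1.
  by rewrite q0 expr0n mulr0 eq_sym oner_eq0.
rewrite -(ltr_pM2r q_gt0) pq1' mul1r.
by rewrite exprn_ilt1.
Qed.

(** Let a, b, c > 1 come from the three quadratic fields and put X = a b c.
    Replacing each of them by its largest power not exceeding X makes them
    comparable: A <= X < a A and likewise for B and C, so
    B C > X^2 / (b c) = a X >= A. *)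
Lemma exists_triangle_units :
    additive_bit bitA -> additive_bit bitB -> additive_bit bitC ->
  exists A B C, triangle_units A B C.
Proof.
move=> MA MB MC.
have [f fK Kf] := bits_bij.
have [tA tB tC] : [/\ bitA (f (true, true, true)), bitB (f (true, true, true))
                     & bitC (f (true, true, true))].
  by have [-> -> ->] := Kf (true, true, true).
have [x [cx intx gt1x]] := sign_unit MA tA.
have [y [cy inty gt1y]] := sign_unit MB tB.
have [z [cz intz gt1z]] := sign_unit MC tC.
set a := iota x in gt1x; set b := iota y in gt1y; set c := iota z in gt1z.
have [a0 b0 c0] : [/\ 0 < a, 0 < b & 0 < c] by split; apply: lt_trans ltr01 _.
pose X := a * b * c.
have [X0 ge1X] : 0 < X /\ 1 <= X.
  by split; [rewrite !mulr_gt0 | rewrite ltW // !mulr_egt1].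
have bracket u : 1 < u -> u <= X ->
    exists n, [/\ 1 < u ^+ n, u ^+ n <= X & X < u * u ^+ n].
  move=> gt1u leuX; have [n /andP[le_n lt_n]] := power_between gt1u ge1X.
  exists n; split=> //; last by rewrite -exprS.
  case: n le_n lt_n => [_|n _ _]; last by rewrite exprn_egt1.
  by rewrite expr1 => /(le_lt_trans leuX); rewrite ltxx.
have le_aX : a <= X by rewrite /X -mulrA ler_peMr ?ltW // mulr_egt1.
have le_bX : b <= X by rewrite /X mulrAC ler_peMl ?ltW // mulr_egt1.
have le_cX : c <= X by rewrite /X ler_peMl ?ltW // mulr_egt1.
have [i [gt1A leA ltA]] := bracket a gt1x le_aX.
have [j [gt1B leB ltB]] := bracket b gt1y le_bX.
have [k [gt1C leC ltC]] := bracket c gt1z le_cX.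
exists (x ^+ i), (y ^+ j), (z ^+ k).
split; first by split; apply: sign_conjugateX.
split; first by rewrite !rmorphXn !rpredX.
rewrite !rmorphXn /= -/a -/b -/c; split=> //.
have key u v U V : 0 < u -> 0 < v -> u * v <= X -> X < u * U -> X < v * V -> X < U * V.
  move=> u0 v0 uvX XU XV; rewrite -(ltr_pM2l X0).
  apply: (@lt_le_trans _ _ ((u * U) * (v * V))).
    by apply: ltr_pM => //; apply: ltW.
  rewrite mulrACA ler_wpM2r // mulr_ge0 // ltW //.
    by rewrite -(pmulr_rgt0 _ u0) (lt_trans X0).
  by rewrite -(pmulr_rgt0 _ v0) (lt_trans X0).
split.
- apply: le_lt_trans leA (key _ _ _ _ b0 c0 _ ltB ltC).
  by rewrite /X -mulrA ler_peMl ?ltW // mulr_gt0.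
- apply: le_lt_trans leB (key _ _ _ _ a0 c0 _ ltA ltC).
  by rewrite /X mulrAC ler_peMr ?ltW // mulr_gt0.
apply: le_lt_trans leC (key _ _ _ _ a0 b0 _ ltA ltB).
by rewrite /X ler_peMr ?ltW // mulr_gt0.
Qed.

Lemma algebraic_unit_triangle_units A B C : triangle_units A B C ->
  algebraic_unit iota (A * B * C).
Proof.
move=> [[cA cB cC] [[intA intB intC] [[gt1A gt1B gt1C] _]]].
have [f fK Kf] := bits_bij.
set t := f (true, true, true); have [tA tB tC] := Kf (true, true, true).
have int_y : iota (A * B * C) \in Aint by rewrite !rmorphM !rpredM.
split=> //; exists (t (A * B * C)); first exact: Aint_gal.
have nz x : 1 < iota x -> x != 0.
  by apply: contraTneq => ->; rewrite rmorph0 ltr10.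
rewrite !rmorphM /= cA cB cC tA tB tC.
by field; rewrite !nz.
Qed.

End ThreeQuadraticFields.
End TotallyReal.

(** * Groups of order 8 *)

(** The subgroup generated by h has index 2, hence is normal, and h^2 is its
    only element of order 2. *)
Lemma square_central (gT : finGroupType) (h : gT) :
  #|gT| = 8%N -> #[h]%g = 4%N -> forall s : gT, (s * h ^+ 2 = h ^+ 2 * s)%g.
Proof.
move=> card8 ord_h s.
have nH : (<[h]> <| [set: gT])%g.
  apply: index2_normal; rewrite ?subsetT // -divgS ?subsetT //.
  by rewrite cardsT card8 -orderE ord_h.
have hs : (h ^ s \in <[h]>)%g.
  by rewrite memJ_norm ?cycle_id // (subsetP (normal_norm nH)) ?inE.
have /cycleP[k Dk] := hs.
have z_neq1 : (h ^+ 2 != 1)%g by rewrite -order_dvdn ord_h.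
have zz : (h ^+ 2 ^+ 2 = 1)%g by apply/eqP; rewrite -expgM -order_dvdn ord_h.
have zs : ((h ^+ 2) ^ s = h ^+ 2 ^+ k)%g by rewrite conjXg Dk -!expgM mulnC.
have zk : (h ^+ 2 ^+ k = h ^+ 2 ^+ odd k)%g.
  rewrite -{1}(odd_double_half k) expgD -mul2n [in X in (_ * X)%g]expgM zz.
  by rewrite expg1n mulg1.
rewrite zk in zs; case: (odd k) zs => zs; last first.
  by move: z_neq1; rewrite -(conjg_eq1 _ s) zs expg0 eqxx.
by rewrite [RHS]conjgC zs expg1.
Qed.

(** A group of order 8 and exponent 2 is a vector space of dimension 3 over
    the field with two elements, and the bits are the coordinates. *)
Lemma elementary_bits (gT : finGroupType) :
    #|gT| = 8%N -> (forall s : gT, s ^+ 2 = 1)%g ->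
  exists a b c : gT -> bool,
    [/\ forall s t, a (s * t)%g = a s (+) a t,
        forall s t, b (s * t)%g = b s (+) b t,
        forall s t, c (s * t)%g = c s (+) c t
      & injective (fun s => (a s, b s, c s))].
Proof.
move=> card8 sq1.
have abelG : (2.-abelem [set: gT])%g.
  rewrite abelemE //; apply/andP; split.
    apply/centsP=> s _ t _; rewrite /commute.
    have inv u : (u^-1 = u :> gT)%g by apply/eqP; rewrite eq_invg_mul -expg2 sq1.
    by rewrite -[RHS]inv invMg !inv.
  by apply/exponentP=> s _.
have abelV : (2.-abelem [set: 'rV['F_2]_3])%g by apply: mx_Fp_abelem.
have /isogP[f injf _] : [set: gT] \isog [set: 'rV['F_2]_3].
  by rewrite (isog_abelem_card _ abelG) abelV !cardsT card8 card_mx card_Fp.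
pose bit (i : 'I_3) s := f s 0 i != 0.
have bitM i s t : bit i (s * t)%g = bit i s (+) bit i t.
  rewrite /bit morphM ?inE // mxE.
  by case: (f s 0 i) => [[|[|m]] ?] //; case: (f t 0 i) => [[|[|m']] ?].
have bit_eq i s t : bit i s = bit i t -> f s 0 i = f t 0 i.
  rewrite /bit; case: (f s 0 i) => [[|[|m]] ?] //.
    by case: (f t 0 i) => [[|[|m']] ?] //= _; apply: val_inj.
  by case: (f t 0 i) => [[|[|m']] ?] //= _; apply: val_inj.
exists (bit 0), (bit 1), (bit 2%:R); split=> // s t [b0 b1 b2].
have /injmP f_inj := injf; apply: f_inj; rewrite ?inE //; apply/rowP=> i; apply: bit_eq.
by case: i => [[|[|[|m]]] lt_m] //; [move: b0 | move: b1 | move: b2];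
  congr (bit _ _ = bit _ _); apply: val_inj.
Qed.

(** * Wandering units *)

Theorem theorem6p2 (K : splittingFieldType rat) (iota : {rmorphism K -> algC})
    (galK : galois 1 {:K}) (degK : \dim {:K} = 8%N)
    (realK : totally_real K) :
  exists u : K, algebraic_unit iota u /\ wandering (iota u).
Proof.
have card8 : #|{: gal_of {:K}}| = 8%N by rewrite card_gal_full.
case: (boolP [forall s : gal_of {:K}, s ^+ 2 == 1]%g) => [/forallP sq1|].
  have [|a [b [c [aM bM cM abc_inj]]]] := elementary_bits card8.
    by move=> s; apply/eqP.
  have [A [B [C ABC]]] := exists_triangle_units iota galK realK abc_inj card8 aM bM cM.
  exists (A * B * C); split.
    exact: (algebraic_unit_triangle_units abc_inj card8 ABC).
  exact: (triangle_units_wandering galK abc_inj card8 ABC).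
(* The order of s divides 8 but not 2, so a power of s has order 4. *)
case/forallPn => s nz_s2.
pose h := (s ^+ (#[s] %/ 4))%g.
have dvd4 : (4 %| #[s]%g)%N.
  have : (#[s]%g %| 8)%N by rewrite -card8 -cardsT order_dvdG ?inE.
  have : ~~ (#[s]%g %| 2)%N by rewrite order_dvdn.
  rewrite (@dvdn_divisors _ 8) // !inE => nd2 /or4P[] /eqP m_eq;
    by rewrite m_eq in nd2 *.
have ord_h : #[h]%g = 4%N.
  by rewrite /h orderXdiv ?dvdn_div // divnA // mulKn.
have nz_z : (h * h != 1)%g.
  by rewrite -expg2 -order_dvdn ord_h.
have zz : (h * h * (h * h) = 1)%g by apply/eqP; rewrite -!expg2 -expgM -order_dvdn ord_h.
have zC t : (t * (h * h) = h * h * t)%g by rewrite -expg2 square_central.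
have [y y_anti] := exists_anti_invariant iota galK realK zz nz_z.
exists y; split; first exact: (algebraic_unit_anti_invariant y_anti).
exact: (anti_invariant_wandering galK realK (erefl _) zC y_anti).
Qed.
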